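(* For all PAL formulas $\phi,\psi\in\mathcal{L}_{pal}$, every Kripke model $\mathcal{M}$ and every world $w$ of $\mathcal{M}$, $$(\mathcal{M},w)\models[\phi]^+_{Ag}\psi \iff (\mathcal{M},w)\models[\phi]\psi.$$
   Context: Languages. $AP$ is a set of atoms and $Ag$ a finite set of agents. For $p\in AP$ and $A\subseteq Ag$, the formulas of public announcement logic $\mathcal{L}_{pal}$ (PAL) are $\psi ::= p \mid \neg\psi \mid \psi\land\psi \mid C_A\psi \mid [\psi]\psi$. The operator $[\cdot]^+_{Ag}$ is the global announcement to the set $Ag$ of all agents; formulas $[\phi]^+_{Ag}\psi$ with $\phi,\psi\in\mathcal{L}_{pal}$ are interpreted by the clause below. Models. A (Kripke) model is $\mathcal{M}=\langle W,\{R_a\}_{a\in Ag},V\rangle$ with $W$ a set of worlds, each $R_a$ an equivalence relation on $W$, and $V:AP\to 2^W$. For $w\in W$, $R_a(w)=\{w' : R_a(w,w')\}$; for $A\subseteq Ag$, $R^C_A=(\bigcup_{a\in A}R_a)^*$ is the reflexive-transitive closure and $R^C_A(w)=\{w' : R^C_A(w,w')\}$. Semantics. The satisfaction set $[\![\varphi]\!]_{\mathcal{M}}\subseteq W$ is defined by: $[\![p]\!]_{\mathcal{M}}=V(p)$; $[\![\neg\psi]\!]_{\mathcal{M}}=W\setminus[\![\psi]\!]_{\mathcal{M}}$; $[\![\psi\land\psi']\!]_{\mathcal{M}}=[\![\psi]\!]_{\mathcal{M}}\cap[\![\psi']\!]_{\mathcal{M}}$; $[\![C_A\psi]\!]_{\mathcal{M}}=\{w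 : R^C_A(w)\subseteq[\![\psi]\!]_{\mathcal{M}}\}$; $[\![[\psi]\psi']\!]_{\mathcal{M}}=\{w : \text{if } w\in[\![\psi]\!]_{\mathcal{M}} \text{ then } w\in[\![\psi']\!]_{\mathcal{M}_\psi}\}$; and $[\![[\psi]^+_{Ag}\psi']\!]_{\mathcal{M}}=\{w : \text{if } w\in[\![\psi]\!]_{\mathcal{M}} \text{ then } w\in[\![\psi']\!]_{\mathcal{M}^+_{(w,\psi,Ag)}}\}$. The model $\mathcal{M}_\psi$ is the restriction of $\mathcal{M}$ to $[\![\psi]\!]_{\mathcal{M}}$: its worlds are $W\cap[\![\psi]\!]_{\mathcal{M}}$, its relations $R_a\cap([\![\psi]\!]_{\mathcal{M}}\times[\![\psi]\!]_{\mathcal{M}})$, its valuation $p\mapsto V(p)\cap[\![\psi]\!]_{\mathcal{M}}$. The refinement $\mathcal{M}^+_{(w,\psi,Ag)}$ has the same worlds and valuation as $\mathcal{M}$ and, for every $a\in Ag$, the relation $R^+_a$ with $R^+_a(v)=R_a(v)\cap[\![\psi]\!]_{\mathcal{M}}$ if $v\in R^C_{Ag}(w)\cap[\![\psi]\!]_{\mathcal{M}}$; $R^+_a(v)=R_a(v)\cap[\![\neg\psi]\!]_{\mathcal{M}}$ if $v\in R^C_{Ag}(w)\cap[\![\neg\psi]\!]_{\mathcal{M}}$; $R^+_a(v)=R_a(v)$ otherwise. We write $(\mathcal{M},w)\models\varphi$ for $w\in[\![\varphi]\!]_{\mathcal{M}}$. *)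

(* Defs.v *)
From Stdlib Require Import Relation_Definitions Relation_Operators.
From mathcomp Require Import all_boot.
From mathcomp Require Import boolp classical_sets.

Set Implicit Arguments.
Unset Strict Implicit.
Unset Printing Implicit Defensive.

Local Open Scope classical_set_scope.

Inductive pal (AP : Type) (Ag : finType) : Type :=
| Atom of AP
| Neg of pal AP Ag
| And of pal AP Ag & pal AP Ag
| Common of {set Ag} & pal AP Ag
| Ann of pal AP Ag & pal AP Ag.

Arguments Atom {AP Ag} _.

(* PAL together with the formulas [phi]^+_Ag psi: the global announcement has
   PAL arguments and occurs only as the outermost operator. *)
Inductive form (AP : Type) (Ag : finType) : Type :=
| Pal of pal AP Ag
| GlobalAnn of pal AP Ag & pal AP Ag.

Record model (AP : Type) (Ag : finType) : Type := Model {
  world :> Type;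
  acc : Ag -> relation world;
  acc_equiv : forall a, equivalence world (acc a);
  valuation : AP -> set world
}.

Definition common_acc (AP : Type) (Ag : finType) (M : model AP Ag)
    (A : {set Ag}) : relation M :=
  clos_refl_trans M (fun v u => exists2 a, a \in A & acc a v u).

Lemma restrict_equiv (AP : Type) (Ag : finType) (M : model AP Ag) (S : set M)
    (a : Ag) :
  equivalence {w : M | S w} (fun v u => acc a (sval v) (sval u)).
Proof.
have [rfl trn sym] := acc_equiv M a.
split=> [v | v u t | v u]; [exact: rfl | exact: trn | exact: sym].
Qed.

Definition restrict (AP : Type) (Ag : finType) (M : model AP Ag) (S : set M) :
    model AP Ag :=
  Model (@restrict_equiv AP Ag M S)
    (fun p => [set v : {w : M | S w} | valuation p (sval v)]).

Unset Implicit Arguments.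

Fixpoint truth {AP : Type} {Ag : finType} (M : model AP Ag) (f : pal AP Ag) :
    set M :=
  match f with
  | Atom p => valuation p
  | Neg g => ~` truth M g
  | And g h => truth M g `&` truth M h
  | Common A g => [set w | common_acc A w `<=` truth M g]
  | Ann g h =>
      [set w | forall gw : truth M g w,
                 truth (restrict (truth M g)) h (exist (truth M g) w gw)]
  end.

Set Implicit Arguments.

Definition refined_acc (AP : Type) (Ag : finType) (M : model AP Ag) (w : M)
    (f : pal AP Ag) (a : Ag) (v : M) : set M :=
  if `[< (common_acc [set: Ag]%SET w `&` truth M f) v >]
  then acc a v `&` truth M f
  else if `[< (common_acc [set: Ag]%SET w `&` truth M (Neg f)) v >]
  then acc a v `&` truth M (Neg f)
  else acc a v.

Lemma refined_equiv (AP : Type) (Ag : finType) (M : model AP Ag) (w : M)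
    (f : pal AP Ag) (a : Ag) : equivalence M (refined_acc w f a).
Proof.
have [rfl trn sym] := acc_equiv M a.
pose C := common_acc [set: Ag]%SET w.
have C_acc v u : acc a v u -> C v -> C u.
  move=> vu Cv; apply: rt_trans Cv _; apply: rt_step.
  by exists a; rewrite ?in_setT.
have accE v u : refined_acc w f a v u <->
    acc a v u /\ (C v -> (truth M f v <-> truth M f u)).
  rewrite /refined_acc; case: asboolP => [[Cv fv]|nCf].
    by split=> [[vu fu]|[vu /(_ Cv)[h _]]]; split=> //; exact: h.
  case: asboolP => [[Cv nfv]|nCnf].
    split=> [[vu nfu]|[vu /(_ Cv)[_ h]]]; split=> //.
    by move=> /h.
  split=> [vu|[]//]; split=> // Cv.
  by exfalso; apply: nCnf; split=> // fv; apply: nCf.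
split=> [v | v u t | v u]; rewrite !accE.
- by split; [exact: rfl |].
- move=> [vu fvu] [ut fut]; split; first exact: trn vu ut.
  by move=> Cv; rewrite (fvu Cv); apply: fut; apply: C_acc vu Cv.
- move=> [vu fvu]; split; first exact: sym.
  by move=> Cu; rewrite fvu //; apply: C_acc (sym _ _ vu) Cu.
Qed.

Definition refine (AP : Type) (Ag : finType) (M : model AP Ag) (w : M)
    (f : pal AP Ag) : model AP Ag :=
  Model (refined_equiv w f) (@valuation AP Ag M).

Definition form_truth (AP : Type) (Ag : finType) (M : model AP Ag)
    (f : form AP Ag) : set M :=
  match f with
  | Pal g => truth M g
  | GlobalAnn g h => [set w | truth M g w -> truth (refine w g) h w]
  end.

Arguments form_truth {AP Ag} M f.

Definition sat (AP : Type) (Ag : finType) (M : model AP Ag) (w : M)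
    (f : form AP Ag) : Prop :=
  form_truth M f w.

Arguments sat {AP Ag} M w f.

(* Main.v *)
(** Since [w] satisfies [phi], every world of the refined model that is reachable
    from [w] also satisfies [phi], and on those worlds the refined relations are
    exactly the restricted ones. Hence inclusion is a bisimulation between the
    restriction and the reachable part of the refinement, and PAL truth is
    invariant under bisimulation. *)

Require Import Defs.
From Stdlib Require Import Relation_Operators.
From mathcomp Require Import all_boot.
From mathcomp Require Import boolp classical_sets.

Set Implicit Arguments.
Unset Strict Implicit.
Unset Printing Implicit Defensive.

Record bisimulation (AP : Type) (Ag : finType) (M N : model AP Ag)
    (Z : M -> N -> Prop) : Prop := Bisimulation {
  bisim_atom : forall p v u, Z v u -> (valuation p v <-> valuation p u);
  bisim_forth : forall a v u v', Z v u -> acc a v v' ->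
    exists2 u', acc a u u' & Z v' u';
  bisim_back : forall a v u u', Z v u -> acc a u u' ->
    exists2 v', acc a v v' & Z v' u'
}.

(** The clauses are symmetric in the two models, so [common_acc_forth] applied to the converse also
    gives the back direction for [Common]. *)
Lemma bisimulation_converse (AP : Type) (Ag : finType) (M N : model AP Ag)
    (Z : M -> N -> Prop) :
  bisimulation Z -> bisimulation (fun u v => Z v u).
Proof.
case=> atomZ forthZ backZ; split=> [p u v /(atomZ p) [] //|a u v u'|a u v v'].
- exact: backZ.
- exact: forthZ.
Qed.

(** Induction on the closure; [u] stays quantified after the path so that, for a composite path, the
    match found for the midpoint starts the second half. *)
Lemma common_acc_forth (AP : Type) (Ag : finType) (M N : model AP Ag)
    (Z : M -> N -> Prop) (A : {set Ag}) v v' :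
  bisimulation Z -> common_acc A v v' ->
  forall u, Z v u -> exists2 u', common_acc A u u' & Z v' u'.
Proof.
move=> bZ; elim=> {v v'} [v v' [a aA vv'] u Zvu|v u Zvu|v t v' _ IHt _ IHv' u Zvu].
- have [u' uu' Zvu'] := bisim_forth bZ Zvu vv'.
  by exists u' => //; apply: rt_step; exists a.
- by exists u => //; apply: rt_refl.
- have [s us Zts] := IHt _ Zvu; have [u' su' Zvu'] := IHv' _ Zts.
  by exists u' => //; apply: rt_trans us su'.
Qed.

Lemma bisimulation_restrict (AP : Type) (Ag : finType) (M N : model AP Ag)
    (Z : M -> N -> Prop) (S : set M) (T : set N) :
  bisimulation Z -> (forall v u, Z v u -> (S v <-> T u)) ->
  @bisimulation _ _ (restrict S) (restrict T) (fun v u => Z (sval v) (sval u)).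
Proof.
move=> bZ ST; split=> [p v u|a v u [v' Sv'] Zvu vv'|a v u [u' Tu'] Zvu uu'].
- exact: (bisim_atom bZ).
- have [u' uu' Zvu'] := bisim_forth bZ Zvu vv'.
  by exists (exist T u' ((ST _ _ Zvu').1 Sv')).
- have [v' vv' Zvu'] := bisim_back bZ Zvu uu'.
  by exists (exist S v' ((ST _ _ Zvu').2 Tu')).
Qed.

(** The induction generalises over models and [Z], because an announcement moves evaluation to the
    restrictions. *)
Lemma truth_bisimulation (AP : Type) (Ag : finType) (f : pal AP Ag)
    (M N : model AP Ag) (Z : M -> N -> Prop) v u :
  bisimulation Z -> Z v u -> (truth M f v <-> truth N f u).
Proof.
elim: f M N Z v u => [p|g IHg|g IHg h IHh|A g IHg|g IHg h IHh] M N Z v u bZ Zvu /=.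
- exact: (bisim_atom bZ).
- by split=> ng /(IHg _ _ _ _ _ bZ Zvu).
- by split=> -[/(IHg _ _ _ _ _ bZ Zvu) ? /(IHh _ _ _ _ _ bZ Zvu)].
- split=> Cg.
  + move=> u' uu'.
    have [v' vv' Zvu'] := common_acc_forth (bisimulation_converse bZ) uu' Zvu.
    by apply/(IHg _ _ _ _ _ bZ Zvu'); apply: Cg.
  + move=> v' vv'; have [u' uu' Zvu'] := common_acc_forth bZ vv' Zvu.
    by apply/(IHg _ _ _ _ _ bZ Zvu'); apply: Cg.
(* Agreement on [g] is needed at all related pairs, not just at [v] and [u], for [Z] to restrict to
   a bisimulation. *)
- have gP v' u' : Z v' u' -> truth M g v' <-> truth N g u' by exact: IHg.
  have bZg := bisimulation_restrict bZ gP.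
  (* Worlds of a restriction carry proofs; the restricted relation ignores them, so [gv] and [gu]
     can be arbitrary. *)
  have hP gv gu : truth (restrict (truth M g)) h (exist _ v gv) <->
      truth (restrict (truth N g)) h (exist _ u gu) by apply: IHh bZg _.
  split=> gh gw.
  + by apply/(hP ((gP _ _ Zvu).2 gw)); exact: gh.
  + by apply/(hP _ ((gP _ _ Zvu).1 gw)); exact: gh.
Qed.

Lemma refined_accE (AP : Type) (Ag : finType) (M : model AP Ag) (w : M)
    (f : pal AP Ag) (a : Ag) v u :
  common_acc [set: Ag]%SET w v -> truth M f v ->
  refined_acc w f a v u <-> acc a v u /\ truth M f u.
Proof. by move=> Cv fv; rewrite /refined_acc; case: asboolP => // -[]. Qed.

(** Reachability is taken in [M], matching the case test of [refined_acc]; being paired with a world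
    of the restriction already forces [f], so [refined_accE] applies to every related pair. *)
Lemma bisimulation_refine_restrict (AP : Type) (Ag : finType)
    (M : model AP Ag) (w : M) (f : pal AP Ag) :
  @bisimulation _ _ (refine w f) (restrict (truth M f))
    (fun v u => v = sval u /\ common_acc [set: Ag]%SET w v).
Proof.
have C_acc a v u : acc a v u -> common_acc [set: Ag]%SET w v ->
    common_acc [set: Ag]%SET w u.
  by move=> vu Cv; apply: rt_trans Cv _; apply: rt_step; exists a.
split=> [p v u [-> _] //|a _ [v fv] v' [/= -> Cv]|a _ [v fv] [u fu] [/= -> Cv] vu].
- move=> /(refined_accE _ _ Cv fv) [vv' fv'].
  by exists (exist _ v' fv') => //; split=> //; apply: C_acc vv' Cv.
- exists u; first exact/(refined_accE _ _ Cv fv).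
  by split=> //; apply: C_acc vu Cv.
Qed.

Theorem corollary3 (AP : Type) (Ag : finType) (phi psi : pal AP Ag)
    (M : model AP Ag) (w : M) :
  sat M w (GlobalAnn phi psi) <-> sat M w (Pal (Ann phi psi)).
Proof.
have psiP fw : truth (refine w phi) psi w <->
    truth (restrict (truth M phi)) psi (exist _ w fw).
  apply: truth_bisimulation (bisimulation_refine_restrict w phi) _.
  by split=> //; apply: rt_refl.
by split=> /= ann fw; apply/psiP; apply: ann.
Qed.
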